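(* For $n\ge 2$, the first non-trivial subdominant term of the polynomial $P(S^n_R)$ in $R$ (the coefficient of $R^{n-1}$ being zero, this is the term of degree $n-2$ in $R$) is given by $$\frac{(n+1)}{3(n-1)}\,\frac{\mu_{n-2}\bigl(S^n_R\bigr)}{(n-2)!\,\omega_{n-2}}.$$
   Context: $P(S^n_R)$ is the polynomial in $R$ (the numerator of the formula for the magnitude of the $n$-sphere of radius $R$ with its intrinsic metric) defined by $$P(S^n_R):=\begin{cases} 2\Bigl(\bigl(\frac{R}{n-1}\bigr)^2+1\Bigr)\Bigl(\bigl(\frac{R}{n-3}\bigr)^2+1\Bigr)\cdots\Bigl(\bigl(\frac{R}{1}\bigr)^2+1\Bigr) & \text{for } n \text{ even},\\ \pi R\Bigl(\bigl(\frac{R}{n-1}\bigr)^2+1\Bigr)\Bigl(\bigl(\frac{R}{n-3}\bigr)^2+1\Bigr)\cdots\Bigl(\bigl(\frac{R}{2}\bigr)^2+1\Bigr) & \text{for } n \text{ odd}, \end{cases}$$ where the product runs over denominators $n-1,n-3,\dots$ decreasing in steps of two down to $1$ ($n$ even) or $2$ ($n$ odd). $\omega_k$ is the volume of the unit $k$-ball (with $\omega_0=1$) and $\sigma_k$ is the volume of the unit $k$-sphere. $\mu_{n-2}$ is the $(n-2)$-nd intrinsic volume: for a closed Riemannian manifold $X$ of dimension $n$, $\mu_{n-2}(X)=\frac{1}{4\pi}\int_X\tau\,d\mathrm{vol}$ where $\tau$ is the scalar curvature. For the $n$-sphere $S^n_R$ of radius $R$ this equals $\mu_{n-2}(S^n_R)=\frac{2\sigma_n}{\sigma_2}\binom{n}{2}R^{n-2}$.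 *)

(* Defs.v *)
From HB Require Import structures.
From mathcomp Require Import all_boot all_order all_algebra.
From mathcomp Require Import all_classical all_reals all_analysis.
From mathcomp Require Import ring lra.
Set Implicit Arguments.
Unset Strict Implicit.
Unset Printing Implicit Defensive.
Import Order.TTheory GRing.Theory Num.Theory.
Import numFieldNormedType.Exports.
Local Open Scope classical_set_scope.
Local Open Scope ring_scope.

(* The radius is the indeterminate; j runs over n-1, n-3, ..., ending at 1 when
   n is even and at 2 when n is odd. *)
Definition magnitude_numerator (R : realType) (n : nat) : {poly R} :=
  (if odd n then pi *: 'X else 2%:P) *
  \prod_(1 <= j < n | odd (n - j)) ((j%:R^-1 *: 'X) ^+ 2 + 1).

Definition sqnorm (R : realType) (n : nat) (x : 'rV[R]_n) : R :=
  \sum_(i < n) x 0 i ^+ 2.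

(* R^n carries two representations: row vectors for calculus, and tuples for
   measure theory, since the library equips only tuples with a product
   sigma-algebra. *)
Definition row_of_tuple (R : realType) (n : nat) (t : n.-tuple R) : 'rV[R]_n :=
  \row_i tnth t i.

Definition cons_pair (T : Type) (n : nat) (p : T * n.-tuple T) : n.+1.-tuple T :=
  [tuple of p.1 :: p.2].

Fixpoint lebesgue_tuple (R : realType) (n : nat) :
    set (n.-tuple (measurableTypeR R)) -> \bar R :=
  match n with
  | 0 => \d_ [tuple]
  | m.+1 => pushforward (lebesgue_measure \x @lebesgue_tuple R m)%E
              (@cons_pair (measurableTypeR R) m)
  end.

(* The library's sigma-finite instance on products is keyed so that it does not
   apply here; this section shows that lebesgue_tuple is a sigma-finite measure. *)
Section LebesgueTupleMeasure.
Variable R : realType.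

Section step.
Variable n : nat.

Let measurable_cons_pair :
  measurable_fun setT (@cons_pair (measurableTypeR R) n).
Proof. by apply: measurable_cons. Qed.

Variable mu : {sigma_finite_measure set (n.-tuple (measurableTypeR R)) -> \bar R}.

Let push := pushforward (lebesgue_measure \x mu)%E
  (@cons_pair (measurableTypeR R) n).

Let push0 : push set0 = 0%E. Proof. exact: measure0. Qed.

Let push_ge0 A : (0 <= push A)%E. Proof. exact: measure_ge0. Qed.

Let push_sigma_additive : semi_sigma_additive push.
Proof. exact: measure_semi_sigma_additive. Qed.

HB.instance Definition _ := isMeasure.Build _ _ _ push
  push0 push_ge0 push_sigma_additive.

Let push_sigma_finite : sigma_finite setT push.
Proof.
have /sigma_finiteP[F [TF ndF Foo]] := sigma_finiteT (@lebesgue_measure R).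
have /sigma_finiteP[G [TG ndG Goo]] := sigma_finiteT mu.
pose u (t : n.+1.-tuple (measurableTypeR R)) : measurableTypeR R * _ :=
  (thead t, [tuple of behead t]).
have mu_ : measurable_fun setT u.
  apply/measurable_fun_pairP; split; last exact: measurable_behead.
  exact: measurable_tnth.
exists (fun k => u @^-1` (F k `*` G k)).
  rewrite -preimage_bigcup -(preimage_setT u); congr (u @^-1` _).
  rewrite -setXTT TF TG predeqE => -[x y]; split.
    move=> [/= [i _ Fx] [j _ Gy]]; exists (maxn i j) => //; split.
    - by move: x Fx; exact/subsetPset/ndF/leq_maxl.
    - by move: y Gy; exact/subsetPset/ndG/leq_maxr.
  by move=> [i _ []/= ? ?]; split; exists i.
move=> k; have [mF Fk] := Foo k; have [mG Gk] := Goo k; split.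
  by rewrite -[X in measurable X]setTI; apply: mu_ => //; exact: measurableX.
rewrite /push /pushforward -comp_preimage.
rewrite (_ : u \o _ = id); last first.
  by apply/funext => -[a t]; congr (_, _); apply/val_inj.
by rewrite preimage_id product_measure1E// lte_mul_pinfty// ge0_fin_numE.
Qed.

HB.instance Definition _ := Measure_isSigmaFinite.Build _ _ _ push push_sigma_finite.

Lemma lebesgue_tuple_step : exists nu : {sigma_finite_measure set _ -> \bar R},
  push = nu.
Proof. by exists push. Qed.

End step.

Lemma lebesgue_tuple_sigma_finite_measure n :
  exists mu : {sigma_finite_measure set (n.-tuple (measurableTypeR R)) -> \bar R},
    @lebesgue_tuple R n = mu.
Proof.
elim: n => [|n [mu muE]]; first by exists (\d_ [tuple]).
by rewrite /= muE; exact: lebesgue_tuple_step.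
Qed.

End LebesgueTupleMeasure.

Definition ball_volume (R : realType) (k : nat) : R :=
  fine (lebesgue_tuple [set t : k.-tuple (measurableTypeR R)
                          | sqnorm (row_of_tuple t) <= 1]).

Section LocalRiemannianGeometry.
Variables (R : realType) (n : nat).

Definition partial (i : 'I_n) (f : 'rV[R]_n -> R) (x : 'rV[R]_n) : R :=
  'D_(delta_mx 0 i) f x.

Variable g : 'rV[R]_n -> 'M[R]_n.

(* christoffel k i j is Gamma^k_{ij}. *)
Definition christoffel (k i j : 'I_n) (x : 'rV[R]_n) : R :=
  2^-1 * \sum_(l < n) invmx (g x) k l *
    (partial i (fun y => g y j l) x + partial j (fun y => g y i l) x
     - partial l (fun y => g y i j) x).

(* R(d_i, d_j) d_k = \sum_l (riemann l k i j) d_l, for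
   R(U, V) W = nabla_U nabla_V W - nabla_V nabla_U W - nabla_[U, V] W. *)
Definition riemann (l k i j : 'I_n) (x : 'rV[R]_n) : R :=
  partial i (christoffel l j k) x - partial j (christoffel l i k) x
  + \sum_(m < n) (christoffel l i m x * christoffel m j k x
                  - christoffel l j m x * christoffel m i k x).

Definition ricci (k j : 'I_n) (x : 'rV[R]_n) : R :=
  \sum_(i < n) riemann i k i j x.

Definition scalar_curvature (x : 'rV[R]_n) : R :=
  \sum_(k < n) \sum_(j < n) invmx (g x) k j * ricci k j x.

Definition volume_density (x : 'rV[R]_n) : R := Num.sqrt (\det (g x)).

(* mu_{n-2} = (4 pi)^-1 \int tau dvol of an n-dimensional Riemannian manifold
   covered, up to a null set, by one chart with domain the whole of R^n, in
   which the metric has matrix g. *)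
Definition intrinsic_volume_codim2 : R :=
  (4 * pi)^-1 *
  fine (\int[@lebesgue_tuple R n]_t
          (scalar_curvature (row_of_tuple t) *
           volume_density (row_of_tuple t))%:E).

End LocalRiemannianGeometry.

(* Row i of 'J phi x is the i-th partial derivative of phi, so that the entries
   of the product are the inner products of the partial derivatives. *)
Definition induced_metric (R : realType) (n m : nat)
    (phi : 'rV[R]_n -> 'rV[R]_m) (x : 'rV[R]_n) : 'M[R]_n :=
  'J phi x *m ('J phi x)^T.

Definition sphere (R : realType) (n : nat) (r : R) : set 'rV[R]_(n + 1) :=
  [set y | sqnorm y = r ^+ 2].

Definition pole (R : realType) (n : nat) (r : R) : 'rV[R]_(n + 1) :=
  row_mx 0 r%:M.

(* Inverse stereographic projection from the pole, scaled so that the unit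
   sphere of R^n goes to the equator: a chart of the sphere minus one point, as
   stereo_inj and stereo_range show. *)
Definition stereo (R : realType) (n : nat) (r : R) (x : 'rV[R]_n) :
    'rV[R]_(n + 1) :=
  (r / (sqnorm x + 1)) *: row_mx (2 *: x) (sqnorm x - 1)%:M.

Lemma sqnorm_ge0 (R : realType) (n : nat) (x : 'rV[R]_n) : 0 <= sqnorm x.
Proof. by apply: sumr_ge0 => i _; exact: sqr_ge0. Qed.

Lemma sqnormZ (R : realType) (n : nat) (a : R) (x : 'rV[R]_n) :
  sqnorm (a *: x) = a ^+ 2 * sqnorm x.
Proof.
by rewrite /sqnorm mulr_sumr; apply: eq_bigr => i _; rewrite mxE exprMn.
Qed.

Lemma sqnorm_row_mx (R : realType) (n : nat) (x : 'rV[R]_n) (a : R) :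
  sqnorm (row_mx x a%:M) = sqnorm x + a ^+ 2.
Proof.
rewrite /sqnorm big_split_ord /= big_ord1; congr (_ + _).
  by apply: eq_bigr => i _; rewrite row_mxEl.
by rewrite row_mxEr mxE.
Qed.

Lemma stereo_inj (R : realType) (n : nat) (r : R) :
  0 < r -> injective (@stereo R n r).
Proof.
move=> r0 x y; rewrite /stereo !scale_row_mx => /eq_row_mx[].
have sx := sqnorm_ge0 x; have sy := sqnorm_ge0 y.
move=> + /matrixP/(_ 0 0); rewrite !mxE /= !mulr1n => xy e.
have {}e : sqnorm x = sqnorm y.
  have : (r / (sqnorm x + 1)) * (sqnorm x - 1) * (sqnorm x + 1) * (sqnorm y + 1) =
    (r / (sqnorm y + 1)) * (sqnorm y - 1) * (sqnorm x + 1) * (sqnorm y + 1).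
    by rewrite e.
  have -> : (r / (sqnorm x + 1)) * (sqnorm x - 1) * (sqnorm x + 1) * (sqnorm y + 1)
    = r * (sqnorm x - 1) * (sqnorm y + 1) by field; lra.
  have -> : (r / (sqnorm y + 1)) * (sqnorm y - 1) * (sqnorm x + 1) * (sqnorm y + 1)
    = r * (sqnorm y - 1) * (sqnorm x + 1) by field; lra.
  rewrite -!mulrA => /mulfI; rewrite gt_eqF// => /(_ isT) h; lra.
move: xy; rewrite e !scalerA; apply: scalerI.
by rewrite mulf_neq0// mulf_neq0 ?invr_eq0 ?gt_eqF//; lra.
Qed.

Lemma stereo_range (R : realType) (n : nat) (r : R) :
  0 < r -> range (@stereo R n r) = @sphere R n r `\ pole n r.
Proof.
move=> r0; apply/seteqP; split => [_ [x _ <-]|y [sy py]] /=.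
  have sx := sqnorm_ge0 x; split.
    rewrite /sphere /= /stereo sqnormZ sqnorm_row_mx sqnormZ.
    by field; lra.
  rewrite /stereo /pole scale_row_mx => /eq_row_mx[_ /matrixP/(_ 0 0)].
  rewrite !mxE /= !mulr1n => e.
  have : r * (sqnorm x - 1) = r * (sqnorm x + 1).
    by rewrite -[in RHS]e; field; lra.
  by move/mulfI; rewrite gt_eqF// => /(_ isT) h; lra.
pose z : 'rV[R]_n := lsubmx y; pose b := rsubmx y 0 0.
have yE : y = row_mx z b%:M.
  by rewrite -[LHS]hsubmxK; congr row_mx; rewrite [LHS]mx11_scalar.
move: sy py; rewrite yE /sphere /= sqnorm_row_mx => zb nb.
have z0 := sqnorm_ge0 z.
have br : b < r.
  have br : b <= r by nra.
  rewrite lt_neqAle br andbT; apply/eqP => bE; apply: nb.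
  rewrite /pole bE; congr row_mx.
  have s0 : sqnorm z = 0 by move: zb; rewrite bE; lra.
  apply/rowP => i; rewrite [RHS]mxE; apply/eqP.
  move/eqP: s0; rewrite /sqnorm psumr_eq0 => [/allP/(_ i)|j _]; last exact: sqr_ge0.
  by rewrite mem_index_enum /= sqrf_eq0 => /(_ isT).
exists ((r - b)^-1 *: z) => //.
have sE : sqnorm ((r - b)^-1 *: z) = (r + b) / (r - b).
  by rewrite sqnormZ (_ : sqnorm z = (r + b) * (r - b)); [field|]; lra.
rewrite /stereo sE scale_row_mx !scalerA; congr row_mx.
  by rewrite -[RHS]scale1r; congr (_ *: _); field; lra.
by rewrite scale_scalar_mx; congr (_%:M); field; lra.
Qed.

(* The round metric, induced by the Euclidean metric of R^(n + 1). *)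
Definition sphere_metric (R : realType) (n : nat) (r : R) :
    'rV[R]_n -> 'M[R]_n :=
  induced_metric (stereo r).

(* Main.v *)
Require Import Defs.
From mathcomp Require Import all_boot all_order all_algebra.
From mathcomp Require Import all_classical all_reals all_analysis.
From mathcomp Require Import measurable_realfun.
From mathcomp Require Import ring lra zify.
Set Implicit Arguments.
Unset Strict Implicit.
Unset Printing Implicit Defensive.
Import Order.TTheory GRing.Theory Num.Theory.
Import numFieldNormedType.Exports.
Local Open Scope classical_set_scope.
Local Open Scope ring_scope.

(** The coefficient of degree n - 2 of the numerator is its leading coefficient
    times the sum of the squares of n - 1, n - 3, ..., which is
    (n - 1) n (n + 1) / 6 for both parities; the leading coefficient is
    2 / (n - 1)!!^2 or pi / (n - 1)!!^2 ([magnitude_numerator_coef]).  So the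
    theorem amounts to an identity between the intrinsic volume of the sphere,
    the volume of the unit (n - 2)-ball and a double factorial.

    In a stereographic chart the round metric is the conformally flat metric
    4 r^2 / (1 + |x|^2)^2 I ([sphere_metricE]).  Its Christoffel symbols are
    linear, with Kronecker deltas as coefficients, in the logarithmic gradient
    of the conformal factor, and the derivatives of this gradient are
    polynomials in itself and 1 / (1 + |x|^2).  Hence the curvature tensor is
    found by contracting deltas, and the scalar curvature is the constant
    n (n - 1) / r^2 ([scalar_curvature_sphere]).  The intrinsic volume is then
    this constant times the total volume, which is (2 r)^n times the integral
    of (1 + |x|^2)^-n over R^n.

    Both this integral and the volume of the unit ball are integrals of radial
    functions, and are computed by integrating out one coordinate at a time
    ([integral_radial_tuple]).  Integrating one coordinate out of
    (a + s^2)^(-p/2) gives a multiple of a^(-(p-1)/2), and out of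
    max (b - s^2, 0)^(q/2) a multiple of max (b, 0)^((q+1)/2); by the
    substitutions s = sqrt a tan t and s = sqrt b sin t the factors are the
    Wallis integrals w_j of cos^j over [-pi/2, pi/2], with j = p - 2 and
    j = q + 1 ([integral_cauchy], [integral_ball_kernel]).  So the ball of
    dimension m has volume w_1 ... w_m, and the integral over R^n is
    w_(n-1) ... w_(2n-2); the product of the two for m = n - 2 telescopes to
    w_1 ... w_(2n-2).  Since w_j w_(j+1) = 2 pi / (j + 1) ([wallis_mul]), these
    products satisfy two-step recursions, which match the one of the double
    factorial ([wallis_prod_double_fact]). *)

(** * The leading coefficients of the numerator *)

(** Raising n by two keeps the parity condition, so that the range only gains
    n + 1; the numerator and its double factorial both inherit their two-step
    recursion from this. *)
Lemma big_odd_step (T : Type) (idx : T) (op : Monoid.law idx)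
    (F : nat -> T) (n : nat) :
  \big[op/idx]_(1 <= j < n.+2 | odd (n.+2 - j)) F j =
  op (\big[op/idx]_(1 <= j < n | odd (n - j)) F j) (F n.+1).
Proof.
rewrite big_mkcond big_nat_recr //= subSnn /=; congr (op _ _).
rewrite [RHS]big_mkcond; case: n => [|n].
  by rewrite !big_geq.
have E : (n.+3 - n.+1 = 2)%N by lia.
rewrite big_nat_recr // E /=.
rewrite Monoid.mulm1; apply: eq_big_nat => j jn.
have {}E : (n.+3 - j = (n.+1 - j).+2)%N by lia.
by rewrite E /= negbK.
Qed.

Lemma magnitude_numerator_step (R : realType) (n : nat) :
  magnitude_numerator R n.+2 =
  magnitude_numerator R n * ((n.+1%:R^-1 *: 'X) ^+ 2 + 1).
Proof. by rewrite /magnitude_numerator big_odd_step /= negbK mulrA. Qed.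

Definition numerator_const (R : realType) (n : nat) : R :=
  if odd n then pi else 2.

(** The double factorial (n - 1)!!. *)
Definition predn_double_fact (n : nat) :=
  (\prod_(1 <= j < n | odd (n - j)) j)%N.

Lemma predn_double_fact_step n :
  predn_double_fact n.+2 = (predn_double_fact n * n.+1)%N.
Proof. exact: big_odd_step. Qed.

Lemma predn_double_fact_gt0 n : (0 < predn_double_fact n)%N.
Proof.
rewrite /predn_double_fact big_nat_cond; apply: prodn_cond_gt0 => j.
by case/andP => /andP[].
Qed.

Lemma size_magnitude_numerator (R : realType) (n : nat) :
  size (magnitude_numerator R n) = n.+1.
Proof.
have pi_neq0 : (pi : R) != 0 by rewrite gt_eqF ?pi_gt0.
elim/ltn_ind: n => -[|[|n]] IH.
- by rewrite /magnitude_numerator big_geq //= mulr1 size_polyC pnatr_eq0.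
- by rewrite /magnitude_numerator big_geq //= mulr1 size_scale // size_polyX.
have size_factor : size ((n.+1%:R^-1 *: 'X) ^+ 2 + 1 : {poly R}) = 3%N.
  rewrite exprZn size_polyDl size_scale ?size_polyXn ?size_poly1 //;
  by rewrite expf_neq0 // invr_eq0 pnatr_eq0.
have IHn := IH n (leqnSn _).
rewrite magnitude_numerator_step size_mul ?size_factor ?IHn ?addn3 //.
  by rewrite -size_poly_eq0 IHn.
by rewrite -size_poly_eq0 size_factor.
Qed.

(** Multiplying by 'X^2 shifts the coefficients of degrees n - 1 and n - 2 to
    the degrees n + 1 and n, which avoids truncated indices; then the statement
    holds from n = 0 on, and the induction steps through
    p_(n+2) = (n + 1)^-2 p_n 'X^2 + p_n. *)
Lemma magnitude_numerator_coef (R : realType) (n : nat) :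
  let p := magnitude_numerator R n in
  let l := numerator_const R n / (predn_double_fact n)%:R ^+ 2 in
  [/\ p`_n = l, (p * 'X^2)`_n.+1 = 0 &
      (p * 'X^2)`_n = l * ((n%:R - 1) * n%:R * (n%:R + 1) / 6)].
Proof.
move=> p l; rewrite {}/p {}/l.
elim/ltn_ind: n => -[|[|n]] IH.
- rewrite /magnitude_numerator /predn_double_fact !big_geq //= !coefMXn.
  rewrite /= mulr1 coefC.
  by split=> //; rewrite /numerator_const /=; field.
- rewrite /magnitude_numerator /predn_double_fact !big_geq //= !coefMXn.
  rewrite /= mulr1.
  by rewrite !coefZ !coefX /=; split=> //; rewrite /numerator_const /=; field.
have [pn pn1 pn2] := IH n (leqnSn _).
have coefE i : (magnitude_numerator R n.+2)`_i =
    n.+1%:R ^- 2 * (magnitude_numerator R n * 'X^2)`_i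
    + (magnitude_numerator R n)`_i.
  rewrite magnitude_numerator_step exprZn mulrDr mulr1 -scalerAr coefD coefZ.
  by rewrite exprVn.
have big_coef i : (n < i)%N -> (magnitude_numerator R n)`_i = 0.
  by move=> ni; rewrite nth_default ?size_magnitude_numerator.
have d_neq0 : (predn_double_fact n)%:R != 0 :> R.
  by rewrite pnatr_eq0 -lt0n predn_double_fact_gt0.
rewrite [(_ * 'X^2)`_n.+3]coefMXn [(_ * 'X^2)`_n.+2]coefMXn !subSS !subn0.
have n1_neq0 : n%:R + 1 != 0 :> R by rewrite natr1 pnatr_eq0.
rewrite !coefE /= pn1 pn2 pn coefMXn !subSS subn0 /= pn !big_coef //.
rewrite predn_double_fact_step natrM /numerator_const /= negbK.
split; first by field; rewrite d_neq0 addrC n1_neq0.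
- by rewrite mulr0 addr0.
rewrite -[n.+2]addn2 -[n.+1]addn1 !natrD.
by field; rewrite d_neq0 n1_neq0.
Qed.

(** * Curvature of the round metric in a stereographic chart *)

Lemma sum_delta (R : pzRingType) (n : nat) (i : 'I_n) (F : 'I_n -> R) :
  \sum_j (i == j)%:R * F j = F i.
Proof.
rewrite (bigD1 i) //= eqxx mul1r big1 ?addr0 // => j ji.
by rewrite eq_sym (negPf ji) mul0r.
Qed.

(** The product and inverse rules of the ring of functions, for functions
    written pointwise. *)
Lemma is_derive_prod (R : realType) (V : normedModType R) (f g : V -> R)
    (x v : V) (a b : R) :
  is_derive x v f a -> is_derive x v g b ->
  is_derive x v (fun y => f y * g y) (f x * b + g x * a).
Proof. exact: is_deriveM. Qed.

Lemma is_derive_inv (R : realType) (V : normedModType R) (f : V -> R)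
    (x v : V) (a : R) :
  f x != 0 -> is_derive x v f a ->
  is_derive x v (fun y => (f y)^-1) (- a / f x ^+ 2).
Proof.
move=> f0 df; have dF : derivable f x v by case: df.
apply: DeriveDef; first exact: derivableV.
by rewrite deriveV // derive_val mulNr mulrC -mulNr.
Qed.

Section RoundMetric.
Variables (R : realType) (n : nat) (r : R).
Implicit Types (x v : 'rV[R]_n) (i j k l m : 'I_n).

Local Notation D x := (sqnorm x + 1).
Local Notation e i := (delta_mx 0 i : 'rV[R]_n).

Lemma stereo_denominator_neq0 x : D x != 0.
Proof. by rewrite gt_eqF // ltr_wpDl ?sqnorm_ge0. Qed.
Local Hint Resolve stereo_denominator_neq0 : core.

Lemma is_derive_coord i x v : is_derive x v (fun y : 'rV[R]_n => y 0 i) (v 0 i).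
Proof.
have d : derivable (id : 'rV[R]_n -> 'rV[R]_n) x v by exact: derivable_id.
apply: DeriveDef; first by move/derivable_mxP: d => /(_ 0 i).
by have := derive_mx d; rewrite derive_id => /matrixP /(_ 0 i); rewrite mxE.
Qed.

Let denominatorE : (fun y => D y) =
  \sum_(j < n) (fun y : 'rV[R]_n => y 0 j) ^+ 2 + cst 1.
Proof.
by apply/funext => y; rewrite /sqnorm /= [in RHS]/GRing.add /= fct_sumE.
Qed.

Lemma is_derive_denominator i x : is_derive x (e i) (fun y => D y) (2 * x 0 i).
Proof.
rewrite denominatorE.
have hs := is_derive_sum (fun j => is_deriveX 2 (is_derive_coord j x (e i))).
apply: is_derive_eq (is_deriveD hs (is_derive_cst (1 : R) x (e i))) _.
rewrite addr0 -(sum_delta i (fun j => 2 * x 0 j)); apply: eq_bigr => j _.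
rewrite mxE /= eq_sym expr1; exact: mulrC.
Qed.

Lemma is_derive_inv_denominator i x :
  is_derive x (e i) (fun y => (D y)^-1) (- 2 * x 0 i / D x ^+ 2).
Proof.
have d := is_derive_denominator i x.
have := @is_derive_inv _ _ (fun y => D y) _ _ _ (stereo_denominator_neq0 x) d.
by move=> /is_derive_eq; apply; rewrite mulNr -mulrN mulrC.
Qed.

Definition conformal_factor x : R := 4 * r ^+ 2 / D x ^+ 2.

(** Half the logarithmic derivative of the conformal factor. *)
Definition log_gradient i x : R := - 2 * x 0 i / D x.

Lemma is_derive_conformal_factor i x :
  is_derive x (e i) conformal_factor
    (2 * conformal_factor x * log_gradient i x).
Proof.
have d := is_derive_inv_denominator i x.
have h := is_derive_prod (is_derive_cst (4 * r ^+ 2 : R) x (e i))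
  (is_derive_prod d d).
rewrite (_ : conformal_factor =
    fun y => cst (4 * r ^+ 2) y * ((D y)^-1 * (D y)^-1)); last first.
  by apply/funext => y; rewrite /conformal_factor expr2 invfM.
by apply: is_derive_eq h _; rewrite /log_gradient /=; field.
Qed.

(** The derivatives of the logarithmic gradient are polynomials in itself and in
    the inverse of the denominator, so that computing the curvature is pure
    algebra from here on. *)
Lemma is_derive_log_gradient i j x :
  is_derive x (e i) (log_gradient j)
    (- 2 * (i == j)%:R / D x + log_gradient i x * log_gradient j x).
Proof.
have d := is_derive_inv_denominator i x.
have h := is_derive_prod (is_derive_cst (- 2 : R) x (e i))
  (is_derive_prod (is_derive_coord j x (e i)) d).
rewrite (_ : log_gradient j = fun y => cst (- 2) y * (y 0 j * (D y)^-1)).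
  apply: is_derive_eq h _; rewrite /log_gradient mxE /= eq_sym.
  by field.
by apply/funext => y; rewrite mulrA.
Qed.

Lemma sum_log_gradient_sqr x :
  \sum_i log_gradient i x ^+ 2 = 4 * sqnorm x / D x ^+ 2.
Proof.
rewrite mulrAC [X in _ * X]/sqnorm mulr_sumr; apply: eq_bigr => j _.
by rewrite /log_gradient; field.
Qed.

Local Notation dl i j := ((i == j)%:R : R).
Local Notation f := (log_gradient).

Let deltaC i j : dl i j = dl j i. Proof. by rewrite eq_sym. Qed.

Lemma differentiable_coordinate i x :
  differentiable (fun y : 'rV[R]_n => y 0 i) x.
Proof. exact: differentiable_coord. Qed.

Lemma differentiable_inv_denominator x : differentiable (fun y => (D y)^-1) x.
Proof.
have dD : differentiable (fun y => D y) x.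
  rewrite denominatorE; apply: differentiableD; last exact: differentiable_cst.
  apply: differentiable_sum => j; apply: differentiableX.
  exact: differentiable_coordinate.
have dI := differentiable_Rinv (stereo_denominator_neq0 x).
exact: (differentiable_comp dD dI).
Qed.

(** The last coordinate r (|x|^2 - 1) / (|x|^2 + 1) is written with |x|^2 in the
    denominator only, which makes its derivative a single term. *)
Definition stereo_coord (a : 'I_(n + 1)) x : R :=
  match fintype.split a with
  | inl j => 2 * r * (x 0 j * (D x)^-1)
  | inr _ => r - 2 * r * (D x)^-1
  end.

Lemma stereoE x a : stereo r x 0 a = stereo_coord a x.
Proof.
rewrite /stereo /stereo_coord mxE [in LHS]mxE.
case: (fintype.split a) => b; first by rewrite mxE; field.
by rewrite ord1 mxE eqxx mulr1n; field.
Qed.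

Lemma differentiable_stereo_coord a x : differentiable (stereo_coord a) x.
Proof.
have dI := differentiable_inv_denominator x.
rewrite /stereo_coord; case: (fintype.split a) => b.
  apply: differentiableM; first exact: differentiable_cst.
  exact: differentiableM (differentiable_coordinate b x) dI.
apply: differentiableB; first exact: differentiable_cst.
exact: differentiableM (differentiable_cst _ _) dI.
Qed.

Lemma differentiable_stereo x : differentiable (stereo r) x.
Proof.
have -> : stereo r =
    \sum_(a < n + 1) fun y => stereo_coord a y *: delta_mx 0 a.
  apply/funext => y; rewrite fct_sumE [LHS]row_sum_delta.
  by apply: eq_bigr => a _; rewrite stereoE.
apply: differentiable_sum => a.
exact: differentiableZl (differentiable_stereo_coord a x).
Qed.

Lemma jacobian_stereo i a x :
  ('J (stereo r) x) i a = partial i (stereo_coord a) x.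
Proof.
have dS := differentiable_stereo x.
have -> : ('J (stereo r) x) i a = (row i ('J (stereo r) x)) 0 a
  by rewrite [RHS]mxE.
rewrite rowE -deriveEjacobian // derive_mx; last exact: diff_derivable.
rewrite mxE /partial; have -> // : (fun y => stereo r y 0 a) = stereo_coord a.
by apply/funext => y; exact: stereoE.
Qed.

Lemma jacobian_stereo_lshift i j x : ('J (stereo r) x) i (lshift 1 j) =
  2 * r / D x * (dl i j - 2 * x 0 i * x 0 j / D x).
Proof.
rewrite jacobian_stereo /partial /stereo_coord (unsplitK (inl j)).
have h := is_derive_prod (is_derive_cst (2 * r : R) x (e i))
  (is_derive_prod (is_derive_coord j x (e i)) (is_derive_inv_denominator i x)).
by rewrite derive_val /= mxE eqxx /= eq_sym; field.
Qed.

Lemma jacobian_stereo_rshift i b x : ('J (stereo r) x) i (rshift n b) =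
  4 * r * x 0 i / D x ^+ 2.
Proof.
rewrite jacobian_stereo /partial /stereo_coord (unsplitK (inr b)).
have h := is_deriveB (is_derive_cst (r : R) x (e i))
  (is_derive_prod (is_derive_cst (2 * r : R) x (e i))
    (is_derive_inv_denominator i x)).
by rewrite derive_val /=; field.
Qed.

(** The contributions of the first n coordinates to the coefficient of x_i x_j
    are - 16 r^2 / D^3 + 16 r^2 |x|^2 / D^4, with D = |x|^2 + 1; the last
    coordinate contributes 16 r^2 / D^4, and the three terms cancel. *)
Lemma sphere_metricE x : sphere_metric r x = (conformal_factor x)%:M.
Proof.
apply/matrixP => i j; rewrite /sphere_metric /induced_metric !mxE.
rewrite big_split_ord /= big_ord1 [_^T (rshift _ _) _]mxE.
rewrite !jacobian_stereo_rshift.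
under eq_bigr => a _.
  rewrite [_^T _ _]mxE !jacobian_stereo_lshift.
  (* Each of the three terms has the form that its summation needs. *)
  have -> : 2 * r / D x * (dl i a - 2 * x 0 i * x 0 a / D x) *
      (2 * r / D x * (dl j a - 2 * x 0 j * x 0 a / D x)) =
    dl i a * ((2 * r / D x) ^+ 2 * (dl j a - 2 * x 0 j * x 0 a / D x))
    + (dl j a * (- (2 * r / D x) ^+ 2 * (2 * x 0 i * x 0 a / D x))
    + 16 * r ^+ 2 * x 0 i * x 0 j / D x ^+ 4 * x 0 a ^+ 2) by field.
  over.
rewrite !big_split /= !sum_delta -mulr_sumr -/(sqnorm x) /conformal_factor.
by rewrite -mulr_natr (eq_sym j); field.
Qed.

Lemma christoffel_sphere k i j : r != 0 -> christoffel (sphere_metric r) k i j =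
  fun x => dl j k * f i x + dl i k * f j x - dl i j * f k x.
Proof.
move=> r0; apply/funext => x; rewrite /christoffel.
have phi0 : conformal_factor x != 0.
  by rewrite !mulf_neq0 ?invr_eq0 ?expf_neq0 ?pnatr_eq0.
have pE l a b : partial l (fun y => sphere_metric r y a b) x =
    2 * conformal_factor x * f l x * dl a b.
  rewrite (_ : (fun y => _) = fun y => conformal_factor y * cst (dl a b) y).
    have h := is_derive_prod (is_derive_conformal_factor l x)
      (is_derive_cst (dl a b) x (e l)).
    by rewrite /partial derive_val /= mulr0 add0r mulrC.
  by apply/funext => y; rewrite sphere_metricE mxE mulr_natr.
under eq_bigr => l _.
  rewrite !pE sphere_metricE invmx_scalar mxE.
  rewrite -[_ *+ (k == l)]mulr_natl.
  rewrite -[_%:R * _ * _]mulrA.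
  over.
by rewrite sum_delta; field; rewrite phi0.
Qed.

Lemma is_derive_christoffel_sphere k i j l x : r != 0 ->
  is_derive x (e l) (christoffel (sphere_metric r) k i j)
   (dl j k * (- 2 * dl l i / D x + f l x * f i x)
    + dl i k * (- 2 * dl l j / D x + f l x * f j x)
    - dl i j * (- 2 * dl l k / D x + f l x * f k x)).
Proof.
move=> r0; rewrite christoffel_sphere //.
have h (a b c : 'I_n) := is_derive_prod (is_derive_cst (dl a b) x (e l))
  (is_derive_log_gradient l c x).
apply: is_derive_eq (is_deriveB (is_deriveD (h j k i) (h i k j)) (h i j k)) _.
by rewrite !mulr0 !addr0.
Qed.

(** The deltas collapse all terms of the product but one, which carries the
    squared norm of the logarithmic gradient. *)
Lemma sum_christoffel_sphere l i j k x : r != 0 ->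
  \sum_m christoffel (sphere_metric r) l i m x *
         christoffel (sphere_metric r) m j k x =
  dl k l * f i x * f j x + dl j l * f i x * f k x - dl j k * f i x * f l x
  + dl i l * (2 * f j x * f k x - dl j k * (4 * sqnorm x / D x ^+ 2))
  - f l x * (dl k i * f j x + dl j i * f k x - dl j k * f i x).
Proof.
move=> r0; rewrite -sum_log_gradient_sqr.
under eq_bigr => m _.
  rewrite !christoffel_sphere //.
  have -> : (dl m l * f i x + dl i l * f m x - dl i m * f l x) *
      (dl k m * f j x + dl j m * f k x - dl j k * f m x) =
    dl l m * (f i x * (dl m k * f j x + dl m j * f k x - dl j k * f m x))
    + (dl k m * (dl i l * f m x * f j x)
    + (dl j m * (dl i l * f m x * f k x)
    - dl i m * (f l x * (dl m k * f j x + dl m j * f k x - dl j k * f m x))))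
    - dl i l * dl j k * f m x ^+ 2.
    by rewrite (deltaC m l) (deltaC k m) (deltaC j m); ring.
  over.
rewrite !big_split /= !sumrN !sum_delta -mulr_sumr.
by rewrite (deltaC k l) (deltaC j l) (deltaC j i) (deltaC k i); ring.
Qed.

(** Constant sectional curvature 1 / r^2: the right-hand side is
    (g_jk delta_il - g_ik delta_jl) / r^2.  The products of components
    of the logarithmic gradient cancel under the antisymmetrization in i and j,
    and its squared norm combines with the second derivatives. *)
Lemma riemann_sphere l k i j x : r != 0 ->
  riemann (sphere_metric r) l k i j x =
  4 / D x ^+ 2 * (dl j k * dl i l - dl i k * dl j l).
Proof.
move=> r0; rewrite /riemann sumrB !sum_christoffel_sphere //.
have h a b c d := is_derive_christoffel_sphere a b c d x r0.
rewrite /partial !derive_val.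
rewrite ?(deltaC j i) ?(deltaC l k) ?(deltaC l i) ?(deltaC l j) ?(deltaC k i).
rewrite ?(deltaC k j).
by field.
Qed.

Lemma ricci_sphere k j x : r != 0 ->
  ricci (sphere_metric r) k j x = (n%:R - 1) * (4 / D x ^+ 2) * dl k j.
Proof.
move=> r0; rewrite /ricci.
under eq_bigr => i _.
  rewrite riemann_sphere // eqxx mulr1 mulrBr (deltaC i k) (mulrCA _ (dl k i)).
  over.
by rewrite sumrB sumr_const sum_delta card_ord -mulr_natl (deltaC j k); ring.
Qed.

Lemma scalar_curvature_sphere x : r != 0 ->
  scalar_curvature (sphere_metric r) x = n%:R * (n%:R - 1) / r ^+ 2.
Proof.
move=> r0; rewrite /scalar_curvature sphere_metricE invmx_scalar.
under eq_bigr => k _.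
  under eq_bigr => j _.
    rewrite ricci_sphere // mxE -[_ *+ (k == j)]mulr_natl.
    rewrite -[_%:R * _ * _]mulrA.
    over.
  rewrite sum_delta eqxx mulr1.
  over.
rewrite sumr_const card_ord -[_ *+ n]mulr_natl /conformal_factor.
by field; rewrite r0 stereo_denominator_neq0.
Qed.

Lemma volume_density_sphere x : 0 <= r ->
  volume_density (sphere_metric r) x = (2 * r) ^+ n / D x ^+ n.
Proof.
move=> r0; rewrite /volume_density sphere_metricE det_scalar.
have -> : conformal_factor x = (2 * r / D x) ^+ 2.
  by rewrite /conformal_factor; field.
rewrite exprAC sqrtr_sqr ger0_norm ?exprn_ge0 ?expr_div_n //.
by rewrite divr_ge0 ?mulr_ge0 ?addr_ge0 ?sqnorm_ge0.
Qed.

End RoundMetric.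

(** * Integrating radial functions coordinate by coordinate *)

Section Slicing.
Variable R : realType.
Local Notation mu := (@lebesgue_measure R).
Local Notation tup n := (n.-tuple (measurableTypeR R)).

Lemma sqnorm_cons (m : nat) (s : R) (t : tup m) :
  sqnorm (row_of_tuple (cons_pair (s, t))) = sqnorm (row_of_tuple t) + s ^+ 2.
Proof.
rewrite /sqnorm big_ord_recl mxE tnth0 addrC; congr (_ + _).
by apply: eq_bigr => i _; rewrite !mxE tnthS.
Qed.

Lemma measurable_sqnorm (m : nat) :
  measurable_fun setT (fun t : tup m => sqnorm (row_of_tuple t)).
Proof.
rewrite /sqnorm; apply: measurable_sum => i.
under eq_fun do rewrite mxE.
apply: measurable_funX; exact: measurable_tnth.
Qed.

Lemma integral_lebesgue_tuple_succ (m : nat) (h : tup m.+1 -> \bar R) :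
  measurable_fun [set: tup m.+1] h -> (forall t, 0 <= h t)%E ->
  (\int[@lebesgue_tuple R m.+1]_t h t =
   \int[@lebesgue_tuple R m]_t \int[mu]_s h (cons_pair (s, t)))%E.
Proof.
move=> mh h0; rewrite /=.
have [nu ->] := @lebesgue_tuple_sigma_finite_measure R m.
have mc : measurable_fun setT (@cons_pair (measurableTypeR R) m).
  exact: measurable_cons.
rewrite (ge0_integral_pushforward mc) //.
rewrite preimage_setT.
have mhc : measurable_fun setT (h \o @cons_pair (measurableTypeR R) m).
  exact: measurableT_comp.
by rewrite (@fubini_tonelli2 _ _ _ _ _ mu nu _ mhc) => // z; exact: h0.
Qed.

(** Tonelli, one coordinate at a time: the profiles K k form a family that
    integrating out one coordinate preserves up to a shift and the factor c k.
    This is only required at nonnegative u, the values of the squared norm of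
    the remaining coordinates. *)
Lemma integral_radial_tuple (m : nat) (K : nat -> R -> R) (c : nat -> R) :
  (forall k, measurable_fun setT (K k)) -> (forall k u, 0 <= K k u) ->
  (forall k, 0 <= c k) ->
  (forall k (u : R), (k < m)%N -> 0 <= u ->
    (\int[mu]_s (K k (u + s ^+ 2)%R)%:E)%E = (c k * K k.+1 u)%:E) ->
  (\int[@lebesgue_tuple R m]_t (K 0%N (sqnorm (row_of_tuple t)))%:E)%E =
   ((\prod_(k < m) c k) * K m 0)%:E.
Proof.
have measurable_radial p (g : R -> R) : measurable_fun setT g ->
    measurable_fun [set: tup p] (fun t => (g (sqnorm (row_of_tuple t)))%:E).
  move=> mg; apply/measurable_EFinP; apply: (measurableT_comp mg).
  exact: measurable_sqnorm.
elim: m K c => [|m IH] K c mK K0 c0 KE.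
  rewrite big_ord0 mul1r integral_dirac //.
    by rewrite diracE mem_set // mul1e /sqnorm big_ord0.
  exact: (measurable_radial _ _ (mK 0%N)).
rewrite integral_lebesgue_tuple_succ; last 2 first.
- exact: (measurable_radial _ _ (mK 0%N)).
- by move=> t; rewrite lee_fin.
have [nu nuE] := @lebesgue_tuple_sigma_finite_measure R m; rewrite nuE.
under eq_integral => t _.
  under eq_integral do rewrite sqnorm_cons.
  rewrite KE ?sqnorm_ge0 // EFinM.
  over.
rewrite ge0_integralZl //; last 3 first.
- exact: (measurable_radial _ _ (mK 1%N)).
- by move=> t _; rewrite lee_fin.
- by rewrite lee_fin.
have := IH (fun k => K k.+1) (fun k => c k.+1); rewrite nuE => -> //.
  by rewrite -EFinM big_ord_recl mulrA.
by move=> k u km u0; rewrite KE.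
Qed.

End Slicing.

(** * Powers of the cosine and two families of integrals over the line *)

Section OneDimensional.
Variable R : realType.
Local Notation mu := (@lebesgue_measure R).
Implicit Types (j q : nat) (a b s t u : R).

(** The odd primitive of cos^j, by the reduction formula for powers of the
    cosine. *)
Fixpoint cos_primitive j : R -> R :=
  match j with
  | 0 => id
  | 1 => sin
  | k.+2 => fun t =>
      (k.+1%:R * cos_primitive k t + cos t ^+ k.+1 * sin t) / k.+2%:R
  end.

(** The Wallis integral of cos^j over [-pi/2, pi/2]. *)
Fixpoint wallis j : R :=
  match j with
  | 0 => pi
  | 1 => 2
  | k.+2 => k.+1%:R / k.+2%:R * wallis k
  end.

Lemma is_derive_cos_primitive j t :
  is_derive t 1 (cos_primitive j) (cos t ^+ j).
Proof.
elim/ltn_ind: j => -[|[|k]] IH.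
- by rewrite expr0; exact: is_derive_id.
- by rewrite expr1; exact: is_derive_sin.
have dk := IH k (leqnSn _).
have h := is_deriveM (is_deriveD
    (is_deriveM (is_derive_cst (k.+1%:R : R) t 1) dk)
    (is_deriveM (is_deriveX k.+1 (is_derive_cos t)) (is_derive_sin t)))
  (is_derive_cst (k.+2%:R^-1 : R) t 1).
rewrite (_ : cos_primitive k.+2 = (cst k.+1%:R * cos_primitive k
    + cos ^+ k.+1 * sin) * cst k.+2%:R^-1); last first.
  by apply/funext => u /=; rewrite /GRing.mul /GRing.add /= exprfctE.
apply: is_derive_eq h _; rewrite !exprfctE /GRing.scale /=.
have := sin2cos2 t; move: (sin t) => si si2.
have k2 : k%:R + 2 != 0 :> R by rewrite -natrD addn2 pnatr_eq0.
rewrite !(mulr0, addr0, add0r) -[k.+2]addn2 -[k.+1]addn1 !natrD !exprD expr1.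
(* The sine occurs only squared, so that it can be eliminated. *)
transitivity (((k%:R + 1) * cos t ^+ k + cos t ^+ k * (cos t) ^+ 2
  - (k%:R + 1) * cos t ^+ k * si ^+ 2) / (k%:R + 2)).
  by field.
by rewrite si2; field.
Qed.

Lemma continuous_cos_primitive j : continuous (cos_primitive j).
Proof.
move=> t; apply/differentiable_continuous/derivable1_diffP.
by case: (is_derive_cos_primitive j t).
Qed.

Lemma cos_primitive_pihalf j : cos_primitive j (pi / 2) = wallis j / 2.
Proof.
elim/ltn_ind: j => -[|[|k]] IH //=; first by rewrite sin_pihalf divff.
by rewrite cos_pihalf expr0n mul0r addr0 IH //; ring.
Qed.

Lemma cos_primitiveN j t : cos_primitive j (- t) = - cos_primitive j t.
Proof.
elim/ltn_ind: j => -[|[|k]] IH //=; first exact: sinN.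
by rewrite cosN sinN IH //; ring.
Qed.

Lemma cos_primitive0 j : cos_primitive j 0 = 0.
Proof. by apply/eqP; rewrite -[_ == 0]eqNr -cos_primitiveN oppr0. Qed.

Lemma wallis_gt0 j : 0 < wallis j.
Proof.
elim/ltn_ind: j => -[|[|k]] IH //=; first exact: pi_gt0.
by rewrite mulr_gt0 ?divr_gt0 ?ltr0n ?IH.
Qed.

Lemma continuous_cos_pow j : continuous (fun t => cos t ^+ j).
Proof.
move=> t; apply: (@continuous_comp _ _ _ (@cos R) (fun x => x ^+ j)).
  exact: continuous_cos.
exact: exprn_continuous.
Qed.

Lemma integral_cos_pow j :
  (\int[mu]_(t in `[(- (pi / 2))%R, (pi / 2)%R]) (cos t ^+ j)%:E)%E =
  (wallis j)%:E.
Proof.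
have pi2_gt0 : 0 < pi / 2 :> R by rewrite divr_gt0 ?pi_gt0.
rewrite (@continuous_FTC2 _ _ (cos_primitive j)).
- by rewrite -EFinB cos_primitiveN cos_primitive_pihalf opprK -splitr.
- by rewrite (lt_trans _ pi2_gt0) // oppr_lt0.
- apply: continuous_subspaceT => t; exact: continuous_cos_pow.
- split.
  + by move=> t _; case: (is_derive_cos_primitive j t).
  + exact/cvg_at_right_filter/continuous_cos_primitive.
  + exact/cvg_at_left_filter/continuous_cos_primitive.
- move=> t _; rewrite derive1E; have := is_derive_cos_primitive j t.
  by move=> ?; exact: derive_val.
Qed.

(** The function max (u, 0)^(q/2), with the convention that it is the indicator
    of the nonnegative reals for q = 0: at u = 1 - |x|^2 this is the indicator
    of the closed unit ball, the profile from which the slicing starts. *)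
Definition ball_kernel q u : R := if 0 <= u then Num.sqrt u ^+ q else 0.

Lemma continuous_ball_arc q b :
  continuous (fun s => Num.sqrt (b - s ^+ 2) ^+ q).
Proof.
move=> s; apply: (@continuous_comp _ _ _ (fun x : R => Num.sqrt (b - x ^+ 2))
  (fun x : R => x ^+ q)); last exact: exprn_continuous.
apply: (@continuous_comp _ _ _ (fun x : R => b - x ^+ 2) Num.sqrt).
  by apply: cvgB; [exact: cvg_cst | exact: exprn_continuous].
exact: sqrt_continuous.
Qed.

(** The substitution s = sqrt b sin t turns the integrand into a power of the
    cosine. *)
Lemma integral_ball_arc q b : 0 < b ->
  (\int[mu]_(s in `[(- Num.sqrt b)%R, Num.sqrt b])
    (Num.sqrt (b - s ^+ 2) ^+ q)%:E)%E = (wallis q.+1 * Num.sqrt b ^+ q.+1)%:E.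
Proof.
move=> b_gt0; set p := Num.sqrt b.
have p_gt0 : 0 < p by rewrite sqrtr_gt0.
have pi2_gt0 : 0 < pi / 2 :> R by rewrite divr_gt0 ?pi_gt0.
pose F t : R := p * sin t.
have dF t : is_derive t 1 F (p * cos t).
  have h := is_deriveM (is_derive_cst (p : R) t 1) (is_derive_sin t).
  by apply: is_derive_eq h _; rewrite scaler0 addr0.
have F'E : (F^`())%classic = fun t => p * cos t.
  by apply/funext => t; rewrite derive1E; apply: derive_val.
have cF : continuous F.
  by move=> t; apply/differentiable_continuous/derivable1_diffP; case: (dF t).
have cF' : continuous (F^`())%classic.
  rewrite F'E => t; apply: cvgM; [exact: cvg_cst | exact: continuous_cos].
have -> : - p = F (- (pi / 2)) by rewrite /F sinN sin_pihalf mulrN mulr1.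
have {1}-> : p = F (pi / 2) by rewrite /F sin_pihalf mulr1.
rewrite (@integration_by_substitution_increasing _ F
    (fun s => Num.sqrt (b - s ^+ 2) ^+ q)); first last.
- exact/continuous_subspaceT/continuous_ball_arc.
- split; first by move=> t _; case: (dF t).
  + exact/cvg_at_right_filter/cF.
  + exact/cvg_at_left_filter/cF.
- by apply: cvgP; apply: cvg_at_left_filter; exact: cF'.
- by apply: cvgP; apply: cvg_at_right_filter; exact: cF'.
- by move=> t _; exact: cF'.
- by move=> x y xI yI xy; rewrite /F ltr_pM2l // ltr_sin.
- by rewrite ltW // (lt_trans _ pi2_gt0) // oppr_lt0.
under eq_integral => t.
  rewrite inE /= in_itv /= => tI.
  rewrite F'E /GRing.mul /= /F.
  have -> : Num.sqrt (b - (p * sin t) ^+ 2) = p * cos t.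
    have -> : b - (p * sin t) ^+ 2 = (p * cos t) ^+ 2.
      by rewrite !exprMn sin2cos2 sqr_sqrtr ?(ltW b_gt0) //; ring.
    by rewrite sqrtr_sqr ger0_norm // mulr_ge0 ?(ltW p_gt0) ?cos_ge0_pihalf.
  rewrite -exprSr exprMn EFinM.
  over.
rewrite /= ge0_integralZl //=; last 3 first.
- apply/measurable_EFinP; apply: measurable_funTS.
  by apply: continuous_measurable_fun; exact: continuous_cos_pow.
- move=> t; rewrite in_itv /= => tI.
  by rewrite lee_fin exprn_ge0 // cos_ge0_pihalf.
- by rewrite lee_fin exprn_ge0 // ltW.
by rewrite integral_cos_pow -EFinM mulrC.
Qed.

Lemma integral_ball_kernel q b :
  (\int[mu]_s (ball_kernel q (b - s ^+ 2)%R)%:E)%E =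
  (wallis q.+1 * ball_kernel q.+1 b)%:E.
Proof.
case: (ltP b 0) => [b_lt0|b_ge0].
  under eq_integral => s _.
    rewrite /ball_kernel ifF; last first.
      by apply/negbTE; rewrite -ltNge (le_lt_trans _ b_lt0) // gerBl sqr_ge0.
    over.
  by rewrite integral0 /ball_kernel leNgt b_lt0 mulr0.
transitivity (\int[mu]_(s in `[(- Num.sqrt b)%R, Num.sqrt b])
    (Num.sqrt (b - s ^+ 2) ^+ q)%:E)%E.
  rewrite [RHS]integral_mkcond; apply: eq_integral => s _.
  rewrite patchE mem_setE in_itv /= -ler_norml -sqrtr_sqr ler_sqrt //.
  by rewrite /ball_kernel subr_ge0; case: ifP.
move: b_ge0; rewrite le_eqVlt => /predU1P[<-|b_gt0].
  rewrite sqrtr0 oppr0 set_itv1 integral_set1 /ball_kernel lexx sqrtr0.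
  by rewrite expr0n mulr0.
by rewrite integral_ball_arc // /ball_kernel (ltW b_gt0).
Qed.

Lemma continuous_cauchy p a : 0 < a ->
  continuous (fun s => Num.sqrt (a + s ^+ 2) ^- p).
Proof.
move=> a_gt0 s.
have r_neq0 : Num.sqrt (a + s ^+ 2) ^+ p != 0.
  by rewrite expf_neq0 // gt_eqF // sqrtr_gt0 ltr_pwDl // sqr_ge0.
apply: (@cvgV _ _ _ _ (fun x : R => Num.sqrt (a + x ^+ 2) ^+ p)) => //.
apply: (@continuous_comp _ _ _ (fun x : R => Num.sqrt (a + x ^+ 2))
  (fun x : R => x ^+ p)); last exact: exprn_continuous.
apply: (@continuous_comp _ _ _ (fun x : R => a + x ^+ 2) Num.sqrt).
  by apply: cvgD; [exact: cvg_cst | exact: exprn_continuous].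
exact: sqrt_continuous.
Qed.

(** This is the substitution s = sqrt a tan t, carried out on the primitive. *)
Lemma is_derive_cauchy_primitive j a s : 0 < a ->
  is_derive s 1
    (fun x => Num.sqrt a ^- j.+1 * cos_primitive j (atan (x / Num.sqrt a)))
    (Num.sqrt (a + s ^+ 2) ^- j.+2).
Proof.
move=> a_gt0; set p := Num.sqrt a.
have p_gt0 : 0 < p by rewrite sqrtr_gt0.
have p_neq0 : p != 0 by rewrite gt_eqF.
have d1 := is_deriveM (is_derive_id s (1 : R)) (is_derive_cst (p^-1 : R) s 1).
have d2 := @is_derive1_comp _ _ (fun x => x / p) s _ _
  (is_derive1_atan (s / p)) d1.
have d3 := @is_derive1_comp _ _ (fun x => atan (x / p)) s _ _
  (is_derive_cos_primitive j (atan (s / p))) d2.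
have d4 := is_deriveM (is_derive_cst (p ^- j.+1 : R) s 1) d3.
apply: is_derive_eq d4 _.
rewrite /GRing.scale /= !mulr0 addr0 add0r mulr1.
have w_gt0 : 0 < 1 + (s / p) ^+ 2 by rewrite ltr_pwDl ?sqr_ge0.
have -> : a + s ^+ 2 = p ^+ 2 * (1 + (s / p) ^+ 2).
  by rewrite -[in LHS](sqr_sqrtr (ltW a_gt0)) -/p; field.
rewrite cos_atan sqrtrM ?sqr_ge0 // sqrtr_sqr (gtr0_norm p_gt0).
rewrite -[in X in _ * (X^-1 * _)](sqr_sqrtr (ltW w_gt0)).
have : Num.sqrt (1 + (s / p) ^+ 2) != 0 by rewrite gt_eqF ?sqrtr_gt0.
move: (Num.sqrt _) => w w_neq0.
rewrite -[j.+2]addn2 -[j.+1]addn1 !exprD !exprMn exprVn.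
by field; rewrite !expf_neq0 ?p_neq0 ?w_neq0.
Qed.

Lemma integral_cauchy j a : 0 < a ->
  (\int[mu]_s (Num.sqrt (a + s ^+ 2) ^- j.+2)%:E)%E =
  (wallis j * Num.sqrt a ^- j.+1)%:E.
Proof.
move=> a_gt0; set p := Num.sqrt a.
have p_gt0 : 0 < p by rewrite sqrtr_gt0.
pose F x : R := p ^- j.+1 * cos_primitive j (atan (x / p)).
have dF s : is_derive s 1 F (Num.sqrt (a + s ^+ 2) ^- j.+2).
  exact: is_derive_cauchy_primitive.
have cF : continuous F.
  by move=> t; apply/differentiable_continuous/derivable1_diffP; case: (dF t).
rewrite (@ge0_symfun_integralT _ (fun s => Num.sqrt (a + s ^+ 2) ^- j.+2)).
- rewrite -set_itvcy.
  rewrite (@ge0_continuous_FTC2y _ _ F _ (p ^- j.+1 * (wallis j / 2))).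
  + rewrite /F mul0r atan0 cos_primitive0 mulr0 sube0 -EFinM; congr _%:E.
    by field; rewrite expf_neq0 // gt_eqF.
  + by move=> s _; rewrite invr_ge0 exprn_ge0.
  + exact/continuous_subspaceT/continuous_cauchy.
  + rewrite -cos_primitive_pihalf; apply: cvgM; first exact: cvg_cst.
    apply: (@cvg_comp _ _ _ (fun x => atan (x / p)) (cos_primitive j) _
      (nbhs (pi / 2))); last exact: continuous_cos_primitive.
    apply: (@cvg_comp _ _ _ (fun x => x / p) (@atan R) _ +oo); last first.
      exact: cvgy_atan.
    by apply: gt0_cvgMly; rewrite ?invr_gt0 //; exact: cvg_id.
  + by move=> s _; case: (dF s).
  + exact/cvg_at_right_filter/cF.
  + by move=> s _; rewrite derive1E; apply: derive_val.
- by move=> s; rewrite invr_ge0 exprn_ge0.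
- exact: continuous_cauchy.
- by move=> s /=; rewrite sqrrN.
Qed.

End OneDimensional.

(** * Volumes of balls and spheres as products of Wallis integrals *)

Section Volumes.
Variable R : realType.
Local Notation tup n := (n.-tuple (measurableTypeR R)).

Lemma measurable_ball_kernel q : measurable_fun setT (@ball_kernel R q).
Proof.
rewrite (_ : ball_kernel q =
    fun u => \1_(`[0, +oo[%classic : set R) u * Num.sqrt u ^+ q).
  apply: measurable_funM; first exact: measurable_indic.
  apply: measurable_funX; apply: continuous_measurable_fun.
  exact: sqrt_continuous.
apply/funext => u; rewrite /ball_kernel indicE mem_setE in_itv /= andbT.
by case: ifP; rewrite ?mul1r ?mul0r.
Qed.

Lemma ball_volumeE (m : nat) : ball_volume R m = \prod_(k < m) wallis R k.+1.
Proof.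
pose K q (u : R) := ball_kernel q (1 - u).
have [nu nuE] := @lebesgue_tuple_sigma_finite_measure R m.
rewrite /ball_volume; set S := [set t | _].
have mS : measurable S.
  rewrite (_ : S =
      setT `&` (fun t : tup m => sqnorm (row_of_tuple t)) @^-1` `]-oo, 1%R]).
    by apply: measurable_sqnorm.
  by rewrite setTI; apply/seteqP; split => t; rewrite /S /= in_itv.
transitivity (fine (\int[@lebesgue_tuple R m]_t
    (K 0 (sqnorm (row_of_tuple t)))%:E)%E).
  rewrite nuE -[S in LHS]setIT -integral_indic //; congr fine.
  apply: eq_integral => t _; rewrite /K /ball_kernel subr_ge0 indicE expr0.
  rewrite /S; case: ifPn => h; first by rewrite mem_set.
  by rewrite memNset //; apply/negP.
rewrite (integral_radial_tuple (c := fun q => wallis R q.+1)).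
- by rewrite /= /K subr0 /ball_kernel ler01 sqrtr1 expr1n mulr1.
- move=> q; apply: (measurableT_comp (measurable_ball_kernel q)).
  exact: measurable_funB.
- by move=> q u; rewrite /K /ball_kernel; case: ifP => // _; rewrite exprn_ge0.
- by move=> q; rewrite ltW ?wallis_gt0.
- move=> q u _ _; rewrite /K -integral_ball_kernel.
  by apply: eq_integral => s _; rewrite opprD addrA.
Qed.

(** Replacing u by the square of its square root changes nothing for u >= 0 and
    makes the profile continuous, hence measurable, on the whole line. *)
Lemma measurable_radial_cauchy p :
  measurable_fun setT (fun u : R => Num.sqrt (1 + Num.sqrt u ^+ 2) ^- p).
Proof.
have ms := continuous_measurable_fun (@sqrt_continuous R).
have mc := continuous_measurable_fun (@continuous_cauchy R p 1 ltr01).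
exact: (measurableT_comp mc ms).
Qed.

Lemma inv_denominatorE n (x : 'rV[R]_n) p :
  (sqnorm x + 1) ^- p = Num.sqrt (1 + Num.sqrt (sqnorm x) ^+ 2) ^- p.*2.
Proof.
rewrite (sqr_sqrtr (sqnorm_ge0 _)) -muln2 mulnC exprM sqr_sqrtr 1?addrC //.
by rewrite addr_ge0 ?sqnorm_ge0.
Qed.

Lemma measurable_inv_denominator n p :
  measurable_fun setT (fun t : tup n => (sqnorm (row_of_tuple t) + 1) ^- p).
Proof.
under eq_fun do rewrite inv_denominatorE.
apply: (measurableT_comp (measurable_radial_cauchy p.*2)).
exact: measurable_sqnorm.
Qed.

Lemma integral_inv_denominator (n : nat) :
  (\int[@lebesgue_tuple R n]_t ((sqnorm (row_of_tuple t) + 1) ^- n)%:E)%E =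
  (\prod_(k < n) wallis R (n.*2 - 2 - k))%:E.
Proof.
pose K q (u : R) := Num.sqrt (1 + Num.sqrt u ^+ 2) ^- (n.*2 - q).
transitivity (\int[@lebesgue_tuple R n]_t (K 0 (sqnorm (row_of_tuple t)))%:E)%E.
  have [nu ->] := @lebesgue_tuple_sigma_finite_measure R n.
  by apply: eq_integral => t _; rewrite inv_denominatorE /K subn0.
rewrite (integral_radial_tuple (c := fun q => wallis R (n.*2 - 2 - q))).
- by rewrite /K sqrtr0 expr0n addr0 sqrtr1 expr1n invr1 mulr1.
- by move=> q; exact: measurable_radial_cauchy.
- by move=> q u; rewrite invr_ge0 exprn_ge0.
- by move=> q; rewrite ltW ?wallis_gt0.
move=> q u qn u_ge0; rewrite /K.
have -> : (n.*2 - q = (n.*2 - 2 - q).+2)%N by lia.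
have -> : (n.*2 - q.+1 = (n.*2 - 2 - q).+1)%N by lia.
have a_gt0 : 0 < 1 + u by rewrite ltr_pwDl.
rewrite (sqr_sqrtr u_ge0) -(integral_cauchy (n.*2 - 2 - q) a_gt0).
by apply: eq_integral => s _; rewrite sqr_sqrtr ?addr_ge0 ?sqr_ge0 // addrA.
Qed.

Lemma wallis_mul (j : nat) : wallis R j * wallis R j.+1 = 2 * pi / j.+1%:R.
Proof.
elim: j => [|j IH]; first by rewrite /= divr1 mulrC.
rewrite [wallis R j.+2]/= mulrCA (mulrC (wallis _ _)) IH.
by field; rewrite -natrD nat1r !pnatr_eq0.
Qed.

Definition wallis_prod (m : nat) := \prod_(k < m) wallis R k.+1.

Lemma wallis_prod_step (m : nat) :
  wallis_prod m.+2 = wallis_prod m * (2 * pi / m.+2%:R).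
Proof. by rewrite /wallis_prod !big_ord_recr /= -wallis_mul mulrA. Qed.

Lemma wallis_prod_neq0 (m : nat) : wallis_prod m != 0.
Proof. by apply/prodf_neq0 => k _; rewrite gt_eqF ?wallis_gt0. Qed.

Lemma wallis_prod_even (m : nat) : wallis_prod m.*2 = pi ^+ m / m`!%:R.
Proof.
elim: m => [|m IH]; first by rewrite /wallis_prod big_ord0 divr1.
rewrite doubleS wallis_prod_step IH factS natrM exprS -doubleS -muln2 natrM.
by field; rewrite nat1r !pnatr_eq0 -lt0n fact_gt0.
Qed.

(** The volumes of the m-ball and of the (m + 2)-sphere are made of consecutive
    Wallis integrals, so that their product is a product of pairs with known
    values. *)
Lemma wallis_prod_sphere (m : nat) :
  wallis_prod m * \prod_(k < m.+2) wallis R (m.+2.*2 - 2 - k) =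
  pi ^+ m.+1 / m.+1`!%:R.
Proof.
rewrite -wallis_prod_even (_ : m.+1.*2 = m + m.+2)%N; last by lia.
rewrite /wallis_prod big_split_ord; congr (_ * _).
rewrite (reindex_inj rev_ord_inj); apply: eq_bigr => k _; congr (wallis R _).
by have := ltn_ord k; rewrite /=; lia.
Qed.

(** Both sides get multiplied by (2 pi)^2 (m + 3)^2 when m increases by two; the
    choice between 2 and pi in the numerator makes them agree at m = 0 and
    m = 1. *)
Lemma wallis_prod_double_fact (m : nat) :
  numerator_const R m * m.+1`!%:R ^+ 2 * wallis_prod m ^+ 2 =
  2 * (2 * pi) ^+ m * (predn_double_fact m.+2)%:R ^+ 2.
Proof.
elim/ltn_ind: m => -[|[|m]] IH.
- rewrite predn_double_fact_step /predn_double_fact big_geq //.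
  rewrite /wallis_prod big_ord0.
  by rewrite /numerator_const !mul1n /= !expr1n !mulr1.
- rewrite predn_double_fact_step /predn_double_fact big_geq //.
  rewrite /wallis_prod big_ord1.
  by rewrite /numerator_const mul1n (_ : 2`! = 2)%N //=; ring.
have {}IH := IH m (leqnSn _).
rewrite wallis_prod_step predn_double_fact_step !factS !natrM.
have -> : numerator_const R m.+2 = numerator_const R m.
  by rewrite /numerator_const /= negbK.
transitivity ((2 * pi) ^+ 2 * m.+3%:R ^+ 2 *
  (numerator_const R m * m.+1`!%:R ^+ 2 * wallis_prod m ^+ 2)).
  by rewrite factS natrM; field; rewrite -natrD pnatr_eq0.
by rewrite IH !exprS; ring.
Qed.

Lemma intrinsic_volume_codim2_sphere (n : nat) (r : R) : 0 < r ->
  intrinsic_volume_codim2 (@sphere_metric R n r) =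
  (4 * pi)^-1 * (n%:R * (n%:R - 1) / r ^+ 2 * (2 * r) ^+ n *
                 \prod_(k < n) wallis R (n.*2 - 2 - k)).
Proof.
move=> r_gt0; rewrite /intrinsic_volume_codim2; congr (_ * _).
have := integral_inv_denominator n.
have [nu ->] := @lebesgue_tuple_sigma_finite_measure R n => E.
under eq_integral => t _.
  rewrite scalar_curvature_sphere ?volume_density_sphere ?gt_eqF ?ltW //.
  rewrite mulrA EFinM.
  over.
rewrite ge0_integralZl //=.
- by rewrite E -EFinM.
- by apply/measurable_EFinP; exact: measurable_inv_denominator.
- by move=> t _; rewrite lee_fin invr_ge0 exprn_ge0 // addr_ge0 ?sqnorm_ge0.
have nn_ge0 : 0 <= n%:R * (n%:R - 1) :> R.
  case: (n) => [|k]; first by rewrite mul0r.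
  by rewrite -[k.+1]addn1 natrD addrK mulr_ge0 // addr_ge0.
rewrite lee_fin mulr_ge0 //; first by rewrite divr_ge0 // exprn_ge0 ?ltW.
by rewrite exprn_ge0 // mulr_ge0 ?ltW.
Qed.

End Volumes.

(** * The subdominant term *)

Theorem theorem9 (R : realType) (n : nat) (hn : (2 <= n)%N) (r : R)
    (hr : 0 < r) :
  [/\ size (magnitude_numerator R n) = n.+1,
      (magnitude_numerator R n)`_(n - 1) = 0,
      (magnitude_numerator R n)`_(n - 2) != 0 &
      (magnitude_numerator R n)`_(n - 2) * r ^+ (n - 2) =
        (n%:R + 1) / (3 * (n%:R - 1)) *
        (intrinsic_volume_codim2 (@sphere_metric R n r) /
         ((n - 2)`!%:R * ball_volume R (n - 2)))].
Proof.
case: n hn => [|[|m]] // _; rewrite subn2 subn1 /=.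
have [_ + +] := magnitude_numerator_coef R m.+2.
rewrite !coefMXn !subSS !subn0 /= => coef1 coef2.
have fact_neq0 k : k`!%:R != 0 :> R by rewrite pnatr_eq0 -lt0n fact_gt0.
have df_neq0 : (predn_double_fact m.+2)%:R != 0 :> R.
  by rewrite pnatr_eq0 -lt0n predn_double_fact_gt0.
have pi_neq0 : (pi : R) != 0 by rewrite gt_eqF ?pi_gt0.
have r_neq0 : r != 0 by rewrite gt_eqF.
have P_neq0 := wallis_prod_neq0 R m.
have c_neq0 : numerator_const R m.+2 != 0.
  by rewrite /numerator_const; case: ifP => // _; rewrite pnatr_eq0.
(* Eliminating the constant of the numerator leaves powers of pi, factorials
   and the volume of the ball, in which both sides are the same fraction. *)
have cE : numerator_const R m.+2 = 2 * (2 * pi) ^+ m *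
    (predn_double_fact m.+2)%:R ^+ 2 / (m.+1`!%:R ^+ 2 * wallis_prod R m ^+ 2).
  rewrite -wallis_prod_double_fact /numerator_const /= negbK.
  by field; rewrite P_neq0 fact_neq0.
have m1_neq0 : m%:R + 1 != 0 :> R by rewrite natr1 pnatr_eq0.
have m2_neq0 : m%:R + 2 != 0 :> R by rewrite -natrD addnS pnatr_eq0.
have m3_neq0 : m%:R + 3 != 0 :> R by rewrite -natrD addnS pnatr_eq0.
have nE : m.+2%:R = m%:R + 2 :> R by rewrite -natrD addn2.
split => //.
- exact: size_magnitude_numerator.
- rewrite coef2 nE.
  have -> : m%:R + 2 - 1 = m%:R + 1 :> R by ring.
  have -> : m%:R + 2 + 1 = m%:R + 3 :> R by ring.
  by rewrite !mulf_neq0 ?invr_eq0 ?expf_neq0 ?c_neq0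
    ?df_neq0 ?m1_neq0 ?m2_neq0 ?m3_neq0 ?pnatr_eq0.
rewrite coef2 intrinsic_volume_codim2_sphere // ball_volumeE.
rewrite -/(wallis_prod R m).
have -> : \prod_(k < m.+2) wallis R (m.+2.*2 - 2 - k) =
    pi ^+ m.+1 / m.+1`!%:R / wallis_prod R m.
  by rewrite -wallis_prod_sphere mulrAC divff // mul1r.
rewrite cE nE factS natrM -natr1 !exprMn !exprS.
move: (pi : R) (predn_double_fact _)%:R pi_neq0 df_neq0 => p d p_neq0 d_neq0.
by field; rewrite P_neq0 fact_neq0 (addrC 1) m1_neq0 r_neq0 p_neq0 d_neq0.
Qed.
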